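(* Let $(X,\sigma,\tau)$ be a finite indecomposable solution of multipermutation level $2$ of size $n$. Let $e_1,\ldots,e_{n-1},f_1,\ldots,f_{n-1}$ be a basis of the free $\mathbb{Z}_n$-module $\mathbb{Z}_n^{2n-2}$ and, for $0\le i\le n-1$ (representing the elements of $\mathbb{Z}_n$), put $c_i=\sum_{k=1}^{i}e_k$ and $d_i=\sum_{k=1}^{i}f_k$ (so $c_0=d_0=0$). Then $(X,\sigma,\tau)$ is a homomorphic image of $\mathcal{S}(\mathbb{Z}_n^{2n-2}\times\mathbb{Z}_n^2,\mathbf{c},\mathbf{d})$, where $\mathbf{c}=(c_i)_{i\in\mathbb{Z}_n}$ and $\mathbf{d}=(d_i)_{i\in\mathbb{Z}_n}$.
   Context: A solution $(X,\sigma,\tau)$ is a nonempty set $X$ with families of bijections $\sigma_x,\tau_x:X\to X$ ($x\in X$) such that $r(x,y)=(\sigma_x(y),\tau_y(x))$ satisfies $(\mathrm{id}\times r)(r\times\mathrm{id})(\mathrm{id}\times r)=(r\times\mathrm{id})(\mathrm{id}\times r)(r\times\mathrm{id})$ on $X^3$. It is indecomposable if $\langle\sigma_x,\tau_x: x\in X\rangle$ acts transitively on $X$. Put $x\approx y$ iff $\sigma_x=\sigma_y$ and $\tau_x=\tau_y$. The operations induced on $X/{\approx}$ are well defined and give a solution $\mathrm{Ret}(X)$. $X$ is a permutation solution (multipermutation level $1$) if $|\mathrm{Ret}(X)|=1$; it has multipermutation level $2$ if it is not a permutation solution and $|\mathrm{Ret}(\mathrm{Ret}(X))|=1$. $\mathbb{Z}_n=\mathbb{Z}/n\mathbb{Z}$.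 For an abelian group $G$ and sequences $\mathbf{c},\mathbf{d}$ in $G$ indexed by $\mathbb{Z}_n$, with $c_0=d_0=0$ and $G=\langle c_i,d_i\mid i\in\mathbb{Z}_n\rangle$, $\mathcal{S}(G\times\mathbb{Z}_n^2,\mathbf{c},\mathbf{d})$ is the solution $(Y,\lambda,\rho)$ on $Y=G\times\mathbb{Z}_n^2$ given by $\lambda_{(a,i,i')}((b,j,j'))=(b+c_{i-i'+j'-j-1},j+1,j')$ and $\rho_{(a,i,i')}((b,j,j'))=(b+d_{i-i'+j'-j+1},j,j'+1)$. A homomorphism $\Phi:(Y,\lambda,\rho)\to(X,\sigma,\tau)$ is a map with $\Phi\lambda_y=\sigma_{\Phi(y)}\Phi$ and $\Phi\rho_y=\tau_{\Phi(y)}\Phi$ for all $y\in Y$; $X$ is a homomorphic image of $Y$ if there is a surjective homomorphism $Y\to X$. *)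

(* Defs.v *)
From HB Require Import structures.
From mathcomp Require Import all_boot all_fingroup all_algebra ring.
From mathcomp Require Import generic_quotient.

Set Implicit Arguments.
Unset Strict Implicit.
Unset Printing Implicit Defensive.

Import GRing.Theory.

Section Braiding.
Variables (X : Type) (s t : X -> X -> X).

Definition braiding (p : X * X) : X * X := (s p.1 p.2, t p.2 p.1).

Definition braiding12 (p : X * X * X) : X * X * X :=
  let: (x, y, z) := p in let: (x', y') := braiding (x, y) in (x', y', z).

Definition braiding23 (p : X * X * X) : X * X * X :=
  let: (x, y, z) := p in let: (y', z') := braiding (y, z) in (x, y', z').

Definition yang_baxter : Prop :=
  forall p, braiding23 (braiding12 (braiding23 p)) =
            braiding12 (braiding23 (braiding12 p)).

Lemma yang_baxterP :
  yang_baxter <->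
  [/\ forall x y z, s x (s y z) = s (s x y) (s (t y x) z),
      forall x y z, t (s (t y x) z) (s x y) = s (t (s y z) x) (t z y)
    & forall x y z, t (t z y) (t (s y z) x) = t z (t y x)].
Proof.
split=> [yb | [h1 h2 h3] [[x y] z]].
  by split=> x y z; have [h1 h2 h3] := yb (x, y, z).
by rewrite /= h1 -h2 h3.
Qed.

End Braiding.

(* sigma S x y is sigma_x(y) and tau S x y is tau_x(y). *)
Record solution (X : Type) := Solution {
  sigma : X -> X -> X;
  tau : X -> X -> X;
  solution_nonempty : inhabited X;
  sigma_bij : forall x, bijective (sigma x);
  tau_bij : forall x, bijective (tau x);
  solution_yb : yang_baxter sigma tau
}.

Definition is_hom (Y X : Type) (T : solution Y) (S : solution X)
    (Phi : Y -> X) : Prop :=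
  (forall y z, Phi (sigma T y z) = sigma S (Phi y) (Phi z)) /\
  (forall y z, Phi (tau T y z) = tau S (Phi y) (Phi z)).

Definition hom_image (Y X : Type) (T : solution Y) (S : solution X) : Prop :=
  exists Phi : Y -> X, is_hom T S Phi /\ (forall x, exists y, Phi y = x).

Section Indecomposable.
Variables (X : finType) (S : solution X).

Definition sigma_perm (x : X) : {perm X} := perm (bij_inj (sigma_bij S x)).
Definition tau_perm (x : X) : {perm X} := perm (bij_inj (tau_bij S x)).

Definition indecomposable : bool :=
  [transitive <<[set sigma_perm x | x : X] :|: [set tau_perm x | x : X]>>%g,
     on [set: X] | 'P].

End Indecomposable.

Section Retract.
Variables (X : finType) (S : solution X).
Local Open Scope quotient_scope.

Definition retract_rel : rel X := fun x y =>
  [forall z, sigma S x z == sigma S y z] && [forall z, tau S x z == tau S y z].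

Lemma retract_relP x y :
  reflect (sigma S x =1 sigma S y /\ tau S x =1 tau S y) (retract_rel x y).
Proof.
apply: (iffP andP) => [[/forallP h1 /forallP h2]|[h1 h2]].
  by split=> z; apply/eqP.
by split; apply/forallP => z; apply/eqP.
Qed.

Lemma retract_rel_equiv : equiv_class_of retract_rel.
Proof.
split.
- by move=> x; apply/retract_relP.
- move=> x y; apply/retract_relP/retract_relP => -[h1 h2];
    by split=> z; rewrite ?h1 ?h2.
- move=> y x z /retract_relP [h1 h2] /retract_relP [h3 h4].
  by apply/retract_relP; split=> w; rewrite ?h1 ?h2 ?h3 ?h4.
Qed.

Canonical retract_equiv := EquivRelPack retract_rel_equiv.

Definition retract_type := {eq_quot retract_equiv}.

Definition retract_pi (x : X) : retract_type := \pi_{eq_quot retract_equiv} x.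
Definition retract_repr (p : retract_type) : X :=
  repr (p : {eq_quot retract_equiv}).

Lemma retract_reprK : cancel retract_repr retract_pi.
Proof. exact: reprK. Qed.

HB.instance Definition _ := Finite.copy retract_type (can_type retract_reprK).

Definition retract_sigma (p q : retract_type) : retract_type :=
  retract_pi (sigma S (retract_repr p) (retract_repr q)).
Definition retract_tau (p q : retract_type) : retract_type :=
  retract_pi (tau S (retract_repr p) (retract_repr q)).

Lemma retract_piW (P : retract_type -> Prop) :
  (forall x, P (retract_pi x)) -> forall p, P p.
Proof. by move=> h p; rewrite -[p]retract_reprK; apply: h. Qed.

Lemma retract_piP x y :
  retract_pi x = retract_pi y <->
  sigma S x =1 sigma S y /\ tau S x =1 tau S y.
Proof.
split=> [/eqmodP /retract_relP //|h].
by apply/eqmodP; apply/retract_relP.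
Qed.

Lemma retract_repr_pi x :
  sigma S (retract_repr (retract_pi x)) =1 sigma S x /\
  tau S (retract_repr (retract_pi x)) =1 tau S x.
Proof. by apply/retract_piP; rewrite retract_reprK. Qed.

Let yb := (yang_baxterP _ _).1 (solution_yb S).

Lemma sigma_compat x y y' :
  retract_pi y = retract_pi y' ->
  retract_pi (sigma S x y) = retract_pi (sigma S x y').
Proof.
case: yb => h1 _ h3 /retract_piP [hs ht]; apply/retract_piP; split=> z.
  have [g _ gK] := sigma_bij S (tau S y x).
  by rewrite -{1}[z]gK -h1 hs h1 -ht gK.
apply: (bij_inj (tau_bij S (tau S y x))).
by rewrite h3 [in RHS]ht h3 ht.
Qed.

Lemma tau_compat x y y' :
  retract_pi y = retract_pi y' ->
  retract_pi (tau S x y) = retract_pi (tau S x y').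
Proof.
case: yb => h1 _ h3 /retract_piP [hs ht]; apply/retract_piP; split=> z.
  apply: (bij_inj (sigma_bij S (sigma S y x))).
  by rewrite -h1 [in RHS]hs -h1 hs.
have [g _ gK] := tau_bij S (sigma S y x).
by rewrite -{1}[z]gK h3 ht -h3 -hs gK.
Qed.

(* The induced operations do not depend on the choice of representatives. *)
Lemma retract_sigma_pi x y :
  retract_sigma (retract_pi x) (retract_pi y) = retract_pi (sigma S x y).
Proof.
rewrite /retract_sigma (retract_repr_pi x).1.
by apply: sigma_compat; rewrite retract_reprK.
Qed.

Lemma retract_tau_pi x y :
  retract_tau (retract_pi x) (retract_pi y) = retract_pi (tau S x y).
Proof.
rewrite /retract_tau (retract_repr_pi x).2.
by apply: tau_compat; rewrite retract_reprK.
Qed.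

Lemma retract_nonempty : inhabited retract_type.
Proof. by case: (solution_nonempty S) => x; exists; exact: retract_pi x. Qed.

Lemma retract_sigma_bij p : bijective (retract_sigma p).
Proof.
elim/retract_piW: p => x; have [g _ gK] := sigma_bij S x.
pose gb q := retract_pi (g (retract_repr q)).
have gbK : cancel gb (retract_sigma (retract_pi x)).
  by move=> q; rewrite retract_sigma_pi gK retract_reprK.
exact: bij_can_bij (injF_bij (can_inj gbK)) _ gbK.
Qed.

Lemma retract_tau_bij p : bijective (retract_tau p).
Proof.
elim/retract_piW: p => x; have [g _ gK] := tau_bij S x.
pose gb q := retract_pi (g (retract_repr q)).
have gbK : cancel gb (retract_tau (retract_pi x)).
  by move=> q; rewrite retract_tau_pi gK retract_reprK.
exact: bij_can_bij (injF_bij (can_inj gbK)) _ gbK.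
Qed.

Lemma retract_yb : yang_baxter retract_sigma retract_tau.
Proof.
case: yb => h1 h2 h3; apply/yang_baxterP.
split; elim/retract_piW=> x; elim/retract_piW=> y; elim/retract_piW=> z.
- rewrite (retract_sigma_pi y z) (retract_sigma_pi x y) (retract_tau_pi y x).
  by rewrite !retract_sigma_pi h1.
- rewrite (retract_sigma_pi y z) (retract_sigma_pi x y).
  rewrite (retract_tau_pi y x) (retract_tau_pi z y).
  rewrite (retract_sigma_pi (tau S y x) z) (retract_tau_pi (sigma S y z) x).
  by rewrite retract_sigma_pi retract_tau_pi h2.
- rewrite (retract_sigma_pi y z) (retract_tau_pi y x) (retract_tau_pi z y).
  by rewrite (retract_tau_pi (sigma S y z) x) !retract_tau_pi h3.
Qed.

Definition retract : solution retract_type :=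
  Solution retract_nonempty retract_sigma_bij retract_tau_bij retract_yb.

End Retract.

Definition permutation_solution (X : finType) (S : solution X) : Prop :=
  #|{: retract_type S}| = 1%N.

Definition multipermutation_level2 (X : finType) (S : solution X) : Prop :=
  ~ permutation_solution S /\
  #|{: retract_type (retract S)}| = 1%N.

Local Open Scope ring_scope.

(* 'Z_n is the ring Z/nZ for 1 < n only; a finite solution of
   multipermutation level 2 always has more than one element. The maps below form a solution for
   arbitrary c and d: c 0 = d 0 = 0 and the generation of G by the values of
   c and d are not needed for this. *)
Section UniversalSolution.
Variables (G : zmodType) (n : nat) (c d : 'Z_n -> G).

Definition lambdaS (x y : G * 'Z_n * 'Z_n) : G * 'Z_n * 'Z_n :=
  let: (a, i, i') := x in let: (b, j, j') := y in
  (b + c (i - i' + j' - j - 1), j + 1, j').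

Definition rhoS (x y : G * 'Z_n * 'Z_n) : G * 'Z_n * 'Z_n :=
  let: (a, i, i') := x in let: (b, j, j') := y in
  (b + d (i - i' + j' - j + 1), j, j' + 1).

Lemma S_nonempty : inhabited (G * 'Z_n * 'Z_n).
Proof. by exists; exact: (0, 0, 0). Qed.

Lemma lambdaS_bij x : bijective (lambdaS x).
Proof.
case: x => [[a i] i'].
exists (fun y => let: (b, j, j') := y in
  (b - c (i - i' + j' - (j - 1) - 1), j - 1, j')) => -[[b j] j'] /=.
  by rewrite !addrK.
by rewrite !subrK.
Qed.

Lemma rhoS_bij x : bijective (rhoS x).
Proof.
case: x => [[a i] i'].
exists (fun y => let: (b, j, j') := y in
  (b - d (i - i' + (j' - 1) - j + 1), j, j' - 1)) => -[[b j] j'] /=.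
  by rewrite !addrK.
by rewrite !subrK.
Qed.

Lemma S_yb : yang_baxter lambdaS rhoS.
Proof.
apply/yang_baxterP; split=> -[[a i] i'] [[b j] j'] [[e k] k'] /=.
- congr (_, _, _); rewrite -!addrA; congr (_ + _).
  by rewrite addrC; congr (c _ + c _); ring.
- congr (_, _, _); rewrite -!addrA; congr (_ + _).
  by rewrite addrC; congr (d _ + c _); ring.
- congr (_, _, _); rewrite -!addrA; congr (_ + _).
  by rewrite addrC; congr (d _ + d _); ring.
Qed.

Definition solS : solution (G * 'Z_n * 'Z_n) :=
  Solution S_nonempty lambdaS_bij rhoS_bij S_yb.

End UniversalSolution.

Definition is_basis (R : nzRingType) (V : lmodType R) (I : finType)
    (b : I -> V) : Prop :=
  (forall v : V, exists a : I -> R, v = \sum_i a i *: b i) /\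
  (forall a : I -> R, \sum_i a i *: b i = 0 -> forall i, a i = 0).

Definition join_families (I J : finType) (V : Type) (e : I -> V) (f : J -> V)
    (k : I + J) : V :=
  match k with inl i => e i | inr j => f j end.

(* With e_1, ..., e_(n-1) indexed from 0, so that e k is e_(k+1), this is
   i |-> e_1 + ... + e_i, where i in 'Z_n is read as its representative in
   {0, ..., n-1}. *)
Definition partial_sums (G : zmodType) (n : nat) (e : 'I_n.-1 -> G)
    (i : 'Z_n) : G :=
  \sum_(k < n.-1 | (k < i)%N) e k.

(* Main.v *)
Require Import Defs.
From mathcomp Require Import all_boot all_fingroup all_algebra cyclic ring.

(** Let R = Ret(X).  Level 2 means that all sigma_x induce one permutation a
of R and all tau_x one permutation b.  Reading the braid relations on classes,
sigma_p sigma_q = sigma_(a q) sigma_(b p) for p, q in R; taking p = a q and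
cancelling gives sigma_q = sigma_(b a q), and the same holds for tau, so that
b = a^-1 because classes are determined by their sigma and tau
([level2_systemP]).

Every object in the proof is an automorphism of X, that is, a permutation g
of X above a permutation c of R with g s_p = s_(c p) g and g t_p = t_(c p) g
([equivariant]).  By indecomposability an automorphism with a fixed point is
trivial ([equivariant_free]).  Hence the group generated by an automorphism
acts freely on X, and the order of each automorphism divides n = |X|
([equivariant_order]); this is why exponents and coefficients in Z/n
suffice.

Write [x] for the class of x.  The diagonal map U x = sigma_(a [x]) x is an
automorphism above a, its mirror image V x = tau_(a^-1 [x]) x is one above
a^-1, and both commute with every automorphism.  For d commuting with a, the
map C_d x = sigma_(d [x]) (U^-1 x) is an automorphism above 1, and so is its
mirror image D_d built from tau and V; these commute with one another and with
U and V, and C_1 = D_1 = 1.  By construction sigma_(d [U x]) x = C_d (U x): a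
move by any sigma is U followed by a translation.

So e_k |-> C_(a^(k-1))^-1 C_(a^k) and f_k |-> D_(a^(k-1))^-1 D_(a^k) extend to
a morphism theta from the free Z/n-module ([basis_morphism]), which
telescopes to theta(c_i) = C_(a^i) and theta(d_i) = D_(a^i).  With a base
point x0, the map Phi(b, j, j') = theta(b) U^j V^j' x0 is then a homomorphism:
the class of Phi(b, j, j') is a^(j - j') [x0], and the index
i - i' + j' - j - 1 of c is the exponent k for which a^k sends the class of
U^(j+1) V^j' x0 to that of Phi(_, i, i').  The image of Phi meets every class,
so it is closed under all sigma and tau; by indecomposability it is X. *)

Set Implicit Arguments.
Unset Strict Implicit.
Unset Printing Implicit Defensive.

Import GRing.Theory.
Local Open Scope group_scope.

(** * Powers with exponents in Z/n, and orders of permutations *)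

Section Exponents.
Variables (gT : finGroupType) (n : nat).
Hypothesis n_gt0 : (0 < n)%N.
Implicit Types (g : gT) (i j : 'Z_n).

Lemma expgN_Zp g i : #[g] %| n -> g ^+ (- i)%R = g ^- i.
Proof.
by move=> gn; apply: (mulgI (g ^+ i)); rewrite -expgD_Zp // subrr mulgV.
Qed.

Lemma expgB_Zp g i j : #[g] %| n -> g ^+ (i - j)%R = g ^+ i * g ^- j.
Proof. by move=> gn; rewrite expgD_Zp // expgN_Zp. Qed.

End Exponents.

(** The orbits of the group generated by [g] all have [#[g]] elements, since
point stabilisers are trivial, and they partition [X]. *)
Lemma semiregular_order_dvdn (X : finType) (g : {perm X}) :
  (forall k x, (g ^+ k) x = x -> g ^+ k = 1) -> #[g] %| #|X|.
Proof.
move=> free; have acts : [acts <[g]>, on [set: X] | 'P].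
  by apply/subsetP=> h _; rewrite !inE; apply/subsetP=> x _; rewrite !inE.
rewrite -cardsT -(acts_sum_card_orbit acts).
apply: dvdn_sum => _ /imsetP[x _ ->]; rewrite card_orbit.
suff -> : 'C_<[g]>[x | 'P] = 1 by rewrite indexg1.
apply/trivgP/subsetP=> _ /setIP[/cycleP[k ->] /astab1P fix_x].
by apply/set1P/(free k x).
Qed.

(** * Morphisms out of a free module over Z/n *)

Section FreeModule.
Variables (n : nat) (V : lmodType 'Z_n) (I : finType) (b : I -> V).
Variables (gT : finGroupType) (E : I -> gT).
Hypotheses (n_gt0 : (0 < n)%N) (basis_b : is_basis b).
Hypotheses (commE : forall k l, commute (E k) (E l)).
Hypothesis (orderE : forall k, #[E k] %| n).

(** The morphism is v |-> prod_k (E k)^(v_k), with v_k the coordinates of v,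
which are additive by uniqueness.  The induction principle in the last clause
transfers to all values of [theta] any property of the [E k] that products
preserve. *)
Lemma basis_morphism : exists theta : V -> gT,
  [/\ forall u v, theta (u + v)%R = theta u * theta v,
      forall k, theta (b k) = E k
    & forall P : gT -> Prop, P 1 -> (forall g h, P g -> P h -> P (g * h)) ->
      (forall k, P (E k)) -> forall v, P (theta v)].
Proof.
have [span free] := basis_b.
have coordP v : exists a : {ffun I -> 'Z_n}, (v == \sum_i a i *: b i)%R.
  have [a ->] := span v; exists [ffun i => a i].
  by apply/eqP/eq_bigr => i _; rewrite ffunE.
pose coord v := xchoose (coordP v).
have coordK v : v = (\sum_i coord v i *: b i)%R.
  exact/eqP/(xchooseP (coordP v)).
have coordU v (a : I -> 'Z_n) : v = (\sum_i a i *: b i)%R -> coord v =1 a.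
  move=> va i; apply/eqP; rewrite -subr_eq0; apply/eqP.
  apply: (free (fun i => coord v i - a i)%R).
  under eq_bigr do rewrite scalerBl.
  by rewrite sumrB -coordK -va subrr.
exists (fun v => \prod_i E i ^+ coord v i); split=> [u v | k | P P1 PM PE v].
- have coordD : coord (u + v)%R =1 (fun i => coord u i + coord v i)%R.
    apply: coordU; under eq_bigr do rewrite scalerDl.
    by rewrite big_split /= -!coordK.
  under eq_bigr do rewrite coordD expgD_Zp //.
  elim: (index_enum I) => [|i r IH]; first by rewrite !big_nil mulg1.
  rewrite !big_cons IH !mulgA; congr (_ * _); rewrite -!mulgA; congr (_ * _).
  apply: commute_prod => j _.
  by apply/commuteX/commute_sym/commuteX; apply: commE.
- have coordE : coord (b k) =1 (fun i => (i == k)%:R)%R.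
    apply: coordU; rewrite (bigD1 k) //= eqxx scale1r big1 ?addr0 // => i.
    by move=> /negPf->; rewrite scale0r.
  under eq_bigr do rewrite coordE.
  (* Only the factor of index k differs from 1. *)
  have one : forall r : seq I, uniq r ->
      \prod_(i <- r) E i ^+ ((i == k)%:R : 'Z_n)%R
        = if k \in r then E k else 1.
    elim=> [|i r IH] /=; first by rewrite big_nil.
    case/andP=> nir ur; rewrite big_cons IH // inE.
    rewrite eq_sym; case: eqP nir => [<-|_] nir /=; last by rewrite expg0 mul1g.
    by rewrite (negPf nir) mulg1 expg1.
  by rewrite one ?index_enum_uniq ?mem_index_enum.
- apply: (big_ind P) => // i _; elim: (nat_of_ord _) => [|m IH].
    by rewrite expg0.
  by rewrite expgS; apply: PM.
Qed.

End FreeModule.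

(** The product of the consecutive quotients telescopes; [C] is indexed by
[nat] since the sum runs up to the representative of [i] in 0, ..., n - 1. *)
Lemma morph_partial_sums (G : zmodType) (gT : finGroupType) (n : nat)
    (e : 'I_n.-1 -> G) (theta : G -> gT) (C : nat -> gT) :
  (1 < n)%N ->
  (forall u v, theta (u + v)%R = theta u * theta v) ->
  C 0 = 1 -> (forall k, theta (e k) = (C k)^-1 * C k.+1) ->
  forall i : 'Z_n, theta (partial_sums e i) = C i.
Proof.
move=> n1 thetaD C0 thetae i; rewrite /partial_sums.
have le_i : (i <= n.-1)%N.
  rewrite -ltnS (prednK (ltnW n1)).
  exact: leq_trans (ltn_ord i) (eq_leq (Zp_cast n1)).
elim: (nat_of_ord i) le_i => [|m IH] ltm.
  rewrite big1 // C0; apply: (mulgI (theta 0%R)).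
  by rewrite -thetaD addr0 mulg1.
rewrite (bigD1 (Ordinal ltm)) //= addrC thetaD thetae /=.
under eq_bigl => k do rewrite -val_eqE /= ltnS andbC -ltn_neqAle.
by rewrite IH ?mulKVg // ltnW.
Qed.

(** * Automorphisms of a solution with cyclic retraction *)

(** An indecomposable solution of level 2, seen over its retraction: [s p] and
[t p] are the permutations sigma and tau attached to the class [p], and
[ssE], [tsE], [ttE] are the three braid relations.  Indecomposability is
encoded by the induction principle [level2_ind]. *)
Record level2_system (X R : finType) (cl : X -> R) (a : {perm R})
    (s t : R -> {perm X}) : Prop := Level2System {
  cl_s : forall p x, cl (s p x) = a (cl x);
  cl_t : forall p x, cl (t p x) = a^-1 (cl x);
  ssE : forall p q x, s p (s q x) = s (a q) (s (a^-1 p) x);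
  ttE : forall p q x, t p (t q x) = t (a^-1 q) (t (a p) x);
  tsE : forall p q x, t (a q) (s p x) = s (a^-1 p) (t q x);
  cl_surj : forall p, exists x, cl x = p;
  level2_ind : forall P : X -> Prop, (exists x, P x) ->
    (forall p x, P x -> P (s p x)) -> (forall p x, P x -> P (t p x)) ->
    forall x, P x
}.

(** The symmetry that yields each statement on tau from the one on sigma. *)
Lemma level2_swap (X R : finType) (cl : X -> R) a s t :
  level2_system cl a s t -> level2_system cl a^-1 t s.
Proof.
case=> h1 h2 h3 h4 h5 h6 h7; split; rewrite ?invgK //.
by move=> P ? ? ?; apply: h7.
Qed.

(** These are the automorphisms of the solution: [s] and [t] at the class of
[x] are sigma_x and tau_x. *)
Definition equivariant (X R : finType) (cl : X -> R) (s t : R -> {perm X})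
    (g : {perm X}) (c : {perm R}) : Prop :=
  [/\ forall x, cl (g x) = c (cl x),
      forall p x, g (s p x) = s (c p) (g x)
    & forall p x, g (t p x) = t (c p) (g x)].

Lemma equivariant_swap (X R : finType) (cl : X -> R) (s t : R -> {perm X}) g c :
  equivariant cl s t g c -> equivariant cl t s g c.
Proof. by case. Qed.

Section Equivariant.
Variables (X R : finType) (cl : X -> R) (s t : R -> {perm X}).
Implicit Types (g h : {perm X}) (c d : {perm R}).
Local Notation equiv := (equivariant cl s t).

Lemma equivariant1 : equiv 1 1.
Proof. by split=> [x|p x|p x]; rewrite !perm1. Qed.

Lemma equivariantM g h c d : equiv g c -> equiv h d -> equiv (g * h) (c * d).
Proof.
by move=> [g1 g2 g3] [h1 h2 h3]; split=> *; rewrite !permM ?(g1,g2,g3,h1,h2,h3).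
Qed.

Lemma equivariantV g c : equiv g c -> equiv g^-1 c^-1.
Proof.
move=> [g1 g2 g3]; split=> [x|p x|p x].
- by apply: (@perm_inj _ c); rewrite permKV -g1 permKV.
- by apply: (@perm_inj _ g); rewrite g2 !permKV.
- by apply: (@perm_inj _ g); rewrite g3 !permKV.
Qed.

Lemma equivariantX g c k : equiv g c -> equiv (g ^+ k) (c ^+ k).
Proof.
move=> gc; elim: k => [|k IH]; first exact: equivariant1.
by rewrite !expgS; apply: equivariantM.
Qed.

Variable a : {perm R}.
Hypothesis L : level2_system cl a s t.

(** Compare the classes of both sides of g s_p = s_(c p) g. *)
Lemma equivariant_commute g c : equiv g c -> commute c a.
Proof.
move=> [g1 g2 _]; apply/permP=> p; have [x <-] := cl_surj L p.
by rewrite !permM -(cl_s L (cl x)) -!g1 g2 (cl_s L).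
Qed.

(** Indecomposability is used twice.  The classes fixed by [c] are stable
under [a], which commutes with [c]; one is fixed, so [c = 1].  Then [g]
commutes with all [s p] and [t p], so its fixed points are stable too. *)
Lemma equivariant_free g c x : equiv g c -> g x = x -> g = 1.
Proof.
move=> gc gx; have [g1 g2 g3] := gc; have ca := equivariant_commute gc.
have caE p : c (a p) = a (c p) by rewrite -!permM ca.
have caVE p : c (a^-1 p) = a^-1 (c p).
  by rewrite -!permM (commuteV ca).
have c1 p : c p = p.
  have [y <-] := cl_surj L p.
  apply: (level2_ind L (P := fun y => c (cl y) = cl y)) y => [|q y cy|q y cy].
  - by exists x; rewrite -g1 gx.
  - by rewrite (cl_s L) caE cy.
  - by rewrite (cl_t L) caVE cy.
apply/permP=> y; rewrite perm1.
apply: (level2_ind L (P := fun y => g y = y)) y => [|p y gy|p y gy].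
- by exists x.
- by rewrite g2 gy c1.
- by rewrite g3 gy c1.
Qed.

Lemma equivariant_order g c : equiv g c -> #[g] %| #|X|.
Proof.
move=> gc; apply: semiregular_order_dvdn => k x.
exact: (equivariant_free (equivariantX k gc)).
Qed.

End Equivariant.

(** * The diagonal permutation and the translations *)

Section Diagonal.
Variables (X R : finType) (cl : X -> R) (a : {perm R}) (s t : R -> {perm X}).
Hypothesis L : level2_system cl a s t.
Local Notation equiv := (equivariant cl s t).

Lemma diag_subproof : injective (fun x => s (a (cl x)) x).
Proof.
move=> x y e; have := congr1 cl e; rewrite !(cl_s L) => /perm_inj clxy.
by move: e; rewrite clxy => /perm_inj.
Qed.

(** Since [a] maps the class of [x] to that of sigma_x x, this is
x |-> sigma_(sigma_x x) x, a map defined by the operations alone; that is why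
it commutes with automorphisms. *)
Definition diag : {perm X} := perm diag_subproof.

Lemma diagE x : diag x = s (a (cl x)) x.
Proof. exact: permE. Qed.

Lemma diag_equivariant : equiv diag a.
Proof.
split=> [x|p x|p x]; rewrite !diagE ?(cl_s L) ?(cl_t L) //.
  by rewrite [RHS](ssE L) permK.
by rewrite (tsE L) permK permKV.
Qed.

Lemma diagV_cl x : cl (diag^-1 x) = a^-1 (cl x).
Proof. by have [-> _ _] := equivariantV diag_equivariant. Qed.

Lemma shift_subproof (d : {perm R}) :
  injective (fun x => s (d (cl x)) (diag^-1 x)).
Proof.
move=> x y e; have := congr1 cl e.
rewrite !(cl_s L) !diagV_cl !permKV => clxy.
by move: e; rewrite clxy => /perm_inj/perm_inj.
Qed.

(** [diag^-1] lowers the class by [a] and [s] raises it back, so classes are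
preserved.  In the model solution this is a translation of the first factor:
for [d = a ^+ i] it is the addition of c_i. *)
Definition shift d : {perm X} := perm (@shift_subproof d).

Lemma shiftE d x : shift d x = s (d (cl x)) (diag^-1 x).
Proof. exact: permE. Qed.

Lemma shift_diag d x : shift d (diag x) = s (d (a (cl x))) x.
Proof. by rewrite shiftE permK diagE (cl_s L). Qed.

Lemma shift1 : shift 1 = 1.
Proof.
apply/permP=> x; rewrite -[x](permKV diag) shift_diag.
by rewrite !perm1 -diagE.
Qed.

Lemma shift_equivariant d : commute d a -> equiv (shift d) 1.
Proof.
move=> da; have daE p : d (a p) = a (d p) by rewrite -!permM da.
have daVE p : d (a^-1 p) = a^-1 (d p).
  by rewrite -!permM (commuteV da).
have [_ V2 V3] := equivariantV diag_equivariant.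
split=> [x|p x|p x]; rewrite perm1.
- by rewrite shiftE (cl_s L) diagV_cl permKV.
- by rewrite !shiftE V2 (cl_s L) [RHS](ssE L) daE.
- by rewrite !shiftE V3 (cl_t L) daVE -{2}[p](permKV a) (tsE L).
Qed.

(** For [d = a ^+ k] this is the formula
lambda (b, j, j') = (b + c_k, j + 1, j') of the model solution: [diag]
increments j, and [shift d] adds c_k. *)
Lemma shift_step g (d : {perm R}) x :
  equiv g 1 -> s (d (a (cl x))) (g x) = (diag * shift d * g) x.
Proof. by case=> _ g2 _; rewrite !permM shift_diag g2 perm1. Qed.

Variables (g : {perm X}) (c : {perm R}).
Hypothesis gc : equiv g c.

Lemma commute_diag : commute g diag.
Proof.
have [g1 g2 _] := gc; have ca := equivariant_commute L gc.
apply/permP=> x; rewrite !permM !diagE g2 g1.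
by rewrite -[a (c _)]permM ca permM.
Qed.

Lemma commute_shift d : commute c d -> commute g (shift d).
Proof.
move=> cd; have [g1 g2 _] := gc; apply/permP=> x.
rewrite !permM !shiftE g2 g1 -[d (c _)]permM cd permM; congr (s _ _).
by rewrite -!permM (commuteV commute_diag).
Qed.

End Diagonal.
(** * The retraction of an indecomposable solution of level 2 *)

Section Level2.
Variables (X : finType) (S : solution X).
Hypotheses (indS : indecomposable S) (lev2 : multipermutation_level2 S).

Lemma indecomposable_ind (P : X -> Prop) :
  (exists x, P x) ->
  (forall x y, P y -> P (sigma S x y)) -> (forall x y, P y -> P (tau S x y)) ->
  forall x, P x.
Proof.
move=> [x0 Px0] Ps Pt x; have := atransP indS _ (in_setT x0).
move/setP/(_ x); rewrite in_setT => /orbitP[_ /gen_prodgP[m [c c_gen ->]] <-].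
rewrite /= /aperm.
suff h y : P y -> P ((\prod_i c i) y) by apply: h.
move: y; apply: (big_ind (fun g : {perm X} => forall y, P y -> P (g y))).
- by move=> y Py; rewrite perm1.
- by move=> g h Pg Ph y Py; rewrite permM; apply/Ph/Pg.
- move=> i _ y Py; have := c_gen i.
  by case/setUP=> /imsetP[z _ ->]; rewrite permE; [apply: Ps | apply: Pt].
Qed.

Lemma level2_card_gt1 : (1 < #|X|)%N.
Proof.
have := leq_card _ (can_inj (@retract_reprK X S)).
have [nperm _] := lev2; have [x] := solution_nonempty S.
have : (0 < #|{: retract_type S}|)%N.
  by apply/card_gt0P; exists (retract_pi S x).
move: nperm; rewrite /permutation_solution.
by case: #|_| => [|[|k]] // _ _; apply: leq_trans.
Qed.

(** The point is that sigma and tau induce inverse permutations of the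
retraction, obtained by cancellation in the braid relations as explained at
the top. *)
Lemma level2_systemP : exists a,
  level2_system (@retract_pi X S) a
    (fun p => sigma_perm S (retract_repr p))
    (fun p => tau_perm S (retract_repr p)).
Proof.
have [_ /eqP/fintype1P[q0 all_q0]] := lev2.
have retE (p q : retract_type S) :
    retract_sigma p =1 retract_sigma q /\ retract_tau p =1 retract_tau q.
  apply: (retract_piP (retract S) p q).1.
  by rewrite [LHS]all_q0 [RHS]all_q0.
have [x0] := solution_nonempty S.
pose p0 := retract_pi S x0; pose pi := @retract_pi X S.
pose a := perm (bij_inj (retract_sigma_bij p0)).
have sE x y : sigma_perm S (retract_repr (pi x)) y = sigma S x y.
  by rewrite permE (retract_repr_pi S x).1.
have tE x y : tau_perm S (retract_repr (pi x)) y = tau S x y.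
  by rewrite permE (retract_repr_pi S x).2.
have a_s x y : pi (sigma S x y) = a (pi y).
  by rewrite permE /pi -retract_sigma_pi (retE p0 (pi x)).1.
have [h1 h2 h3] := (yang_baxterP _ _).1 (solution_yb S).
pose b := retract_tau p0.
have b_t x y : pi (tau S x y) = b (pi y).
  by rewrite /b /pi -retract_tau_pi (retE p0 (pi x)).2.
set s := fun p => sigma_perm S (retract_repr p).
set t := fun p => tau_perm S (retract_repr p).
have ab p : a (b p) = b (a p).
  elim/retract_piW: p => y.
  by have := congr1 pi (h2 x0 y x0); rewrite a_s !b_t a_s => <-.
have ssE p q x : s p (s q x) = s (a q) (s (b p) x).
  elim/retract_piW: p => y; elim/retract_piW: q => z.
  by rewrite -(b_t z) -(a_s y) /s !sE h1.
have ttE p q x : t p (t q x) = t (b q) (t (a p) x).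
  elim/retract_piW: p => y; elim/retract_piW: q => z.
  by rewrite -(b_t y) -(a_s z) /t !tE h3.
have tsE p q x : t (a q) (s p x) = s (b p) (t q x).
  elim/retract_piW: p => y; elim/retract_piW: q => z.
  rewrite -(a_s (tau S x y)) -(b_t (sigma S x z)) /t /s !sE !tE.
  exact: h2.
have ba p : b (a p) = p.
  (* p and b (a p) have the same sigma by ssE at (a p, p), and the same tau by
     ttE at (b p, p). *)
  suff : retract_pi S (retract_repr p) = retract_pi S (retract_repr (b (a p))).
    by rewrite !retract_reprK.
  apply/retract_piP; split=> x.
    by have /perm_inj := ssE (a p) p x; rewrite /s !permE.
  by have /perm_inj := ttE (b p) p x; rewrite ab /t !permE.
have bE p : b p = a^-1 p by apply: (@perm_inj _ a); rewrite ab ba permKV.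
exists a; split.
- by move=> p x; rewrite -(a_s (retract_repr p)) /s permE.
- by move=> p x; rewrite -bE -(b_t (retract_repr p)) /t permE.
- by move=> p q x; rewrite -bE.
- by move=> p q x; rewrite -bE.
- by move=> p q x; rewrite -bE.
- by move=> p; exists (retract_repr p); rewrite retract_reprK.
- move=> P P0 Ps Pt; apply: indecomposable_ind => // x y Py.
    by rewrite -sE; apply: Ps.
  by rewrite -tE; apply: Pt.
Qed.

End Level2.

(** * The homomorphism from the universal solution *)

Theorem proposition7p10 (X : finType) (S : solution X) (n : nat)
    (cardX : #|X| = n)
    (indX : indecomposable S)
    (levelX : multipermutation_level2 S)
    (e f : 'I_n.-1 -> 'rV['Z_n]_(2 * n - 2))
    (basis_ef : is_basis (join_families e f)) :
  hom_image (solS (partial_sums e) (partial_sums f)) S.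
Proof.
have n1 : (1 < n)%N by rewrite -cardX; apply: level2_card_gt1 levelX.
have n0 : (0 < n)%N by apply: ltnW.
have [a] := level2_systemP indX levelX.
set cl := @retract_pi X S.
set s := fun p => sigma_perm S (retract_repr p).
set t := fun p => tau_perm S (retract_repr p) => L.
have L' := level2_swap L.
have sE x y : sigma S x y = s (cl x) y by rewrite permE (retract_repr_pi S x).1.
have tE x y : tau S x y = t (cl x) y by rewrite permE (retract_repr_pi S x).2.
have order_n g c : equivariant cl s t g c -> #[g] %| n.
  by move=> gc; rewrite -cardX; exact: (equivariant_order L gc).
pose U := diag L; pose V := diag L'.
have Ua : equivariant cl s t U a := diag_equivariant L.
have Va : equivariant cl s t V a^-1 := equivariant_swap (diag_equivariant L').
have UV : commute U V := commute_diag L' (equivariant_swap Ua).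
pose C k := shift L (a ^+ k); pose D k := shift L' (a ^+ k).
have C1 k : equivariant cl s t (C k) 1.
  exact/shift_equivariant/commute_sym/commuteX.
have D1 k : equivariant cl s t (D k) 1.
  apply/equivariant_swap/shift_equivariant.
  exact/commute_sym/commuteX/commute_sym/commuteV.
pose E (x : 'I_n.-1 + 'I_n.-1) :=
  match x with inl k => (C k)^-1 * C k.+1 | inr k => (D k)^-1 * D k.+1 end.
have E1 x : equivariant cl s t (E x) 1.
  case: x => k; rewrite -(mulVg 1);
    by apply: equivariantM => //; apply: equivariantV.
have commE k l : commute (E k) (E l).
  have cC m : commute (E k) (C m).
    exact/(commute_shift L (E1 k))/commute_sym/commute1.
  have cD m : commute (E k) (D m).
    exact/(commute_shift L' (equivariant_swap (E1 k)))/commute_sym/commute1.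
  by case: l => l; apply: commuteM => //; apply: commuteV.
have orderE k : #[E k] %| n := order_n _ _ (E1 k).
have [theta [thetaD thetaE theta_ind]] :=
  basis_morphism n0 basis_ef commE orderE.
have thetaC i : theta (partial_sums e i) = C i.
  apply: morph_partial_sums => // [|k]; first by rewrite /C expg0 shift1.
  exact: (thetaE (inl k)).
have thetaDi i : theta (partial_sums f i) = D i.
  apply: morph_partial_sums => // [|k]; first by rewrite /D expg0 shift1.
  exact: (thetaE (inr k)).
have theta1 v : equivariant cl s t (theta v) 1.
  apply: (theta_ind (fun g => equivariant cl s t g 1)) => // [|g h g1 h1].
    exact: equivariant1.
  by rewrite -(mulg1 1); apply: equivariantM.
have Un : #[U] %| n := order_n _ _ Ua.
have Vn : #[V] %| n := order_n _ _ Va.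
have an : #[a] %| n.
  (* a^n is the permutation of the classes below U^n = 1. *)
  rewrite order_dvdn; apply/eqP/permP=> p; have [x <-] := cl_surj L p.
  have [<- _ _] := equivariantX n Ua.
  by move: Un; rewrite order_dvdn => /eqP->; rewrite !perm1.
have [x0] := solution_nonempty S.
pose W (j j' : 'Z_n) := U ^+ j * V ^+ j'.
have Wa j j' : equivariant cl s t (W j j') (a ^+ (j - j')%R).
  rewrite expgB_Zp // -expVgn.
  by apply: equivariantM; apply: equivariantX.
pose Phi (y : 'rV['Z_n]_(2 * n - 2) * 'Z_n * 'Z_n) :=
  let: (b, j, j') := y in (W j j' * theta b) x0.
have clPhi b j j' : cl (Phi (b, j, j')) = (a ^+ (j - j')%R) (cl x0).
  rewrite /Phi permM; have [-> _ _] := theta1 b.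
  by have [-> _ _] := Wa j j'; rewrite perm1.
have expS (gT : finGroupType) (g : gT) (j : 'Z_n) :
  #[g] %| n -> g ^+ (j + 1)%R = g ^+ j * g.
  by move=> gn; rewrite expgD_Zp.
have Phi_s y z : Phi (lambdaS (partial_sums e) y z) = sigma S (Phi y) (Phi z).
  case: y z => [[b i] i'] [[b' j] j']; rewrite sE clPhi /=.
  set k := (i - i' + j' - j - 1)%R.
  have -> : (a ^+ (i - i')%R) (cl x0) = (a ^+ k) (a (cl (W j j' x0))).
    have [-> _ _] := Wa j j'; rewrite -!permM.
    have -> : (i - i' = (j - j') + (1 + k))%R by rewrite /k; ring.
    by rewrite !expgD_Zp // ?mulgA.
  rewrite [X in _ = s _ X]permM (shift_step L) //.
  rewrite -permM (addrC b') thetaD thetaC /W expS // -!/U -!/(C _).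
  by rewrite !mulgA -[_ * U * _]mulgA (commuteX _ UV) !mulgA.
have Phi_t y z : Phi (rhoS (partial_sums f) y z) = tau S (Phi y) (Phi z).
  case: y z => [[b i] i'] [[b' j] j']; rewrite tE clPhi /=.
  set k := (i - i' + j' - j + 1)%R.
  have -> : (a ^+ (i - i')%R) (cl x0) = (a ^+ k) (a^-1 (cl (W j j' x0))).
    have [-> _ _] := Wa j j'; rewrite -!permM.
    have -> : (i - i' = (j - j') + (- 1 + k))%R by rewrite /k; ring.
    rewrite (expgD_Zp _ (- 1 + k)%R) // (expgD_Zp (- 1)%R) //.
    by rewrite expgN_Zp // ?mulgA.
  rewrite [X in _ = t _ X]permM (shift_step L') //; last exact: equivariant_swap.
  rewrite -permM (addrC b') thetaD thetaDi /W expS // -!/V -!/(D _).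
  by rewrite !mulgA.
exists Phi; split; first by [].
(* As [a] has order dividing n, the exponents can be taken in Z/n. *)
have cl_x0 x : exists k : 'Z_n, cl x = (a ^+ k) (cl x0).
  move: x; apply: (level2_ind L) => [|p x [k clx]|p x [k clx]].
  - by exists x0, 0%R; rewrite expg0 perm1.
  - exists (k + 1)%R.
    by rewrite (cl_s L) clx expS // permM.
  - exists (k - 1)%R.
    by rewrite (cl_t L) clx expgB_Zp // permM.
have clPhi_surj p : exists y, p = cl (Phi y).
  have [x <-] := cl_surj L p; have [k ->] := cl_x0 x.
  by exists (0%R, k, 0%R); rewrite clPhi subr0.
apply: (level2_ind L) => [|p _ [z <-]|p _ [z <-]].
- by exists (Phi (0%R, 0%R, 0%R)), (0%R, 0%R, 0%R).
- have [y ->] := clPhi_surj p.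
  by exists (lambdaS (partial_sums e) y z); rewrite Phi_s sE.
- have [y ->] := clPhi_surj p.
  by exists (rhoS (partial_sums f) y z); rewrite Phi_t tE.
Qed.
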